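(* Let $R>0$, let $\mathcal{H}$ be a real separable Hilbert space, let $y\in\mathcal{H}$, and let $K:\ell_2(\Lambda)\to\mathcal{H}$ be a bounded linear operator with $\|K\|_{\ell_2\to\mathcal{H}}<1$; put $r:=\|K^*K\|_{\ell_2\to\ell_2}<1$. Assume that the minimizers $\tilde x$ of $\mathcal{D}(x)=\|Kx-y\|^2$ on $B_R$ are not global minimizers of $\mathcal{D}$, i.e. $K^*(y-K\tilde x)\neq 0$. Let $x^{(0)}\in\ell_2(\Lambda)$ be arbitrary, let $(\beta^{(n)})_{n\in\mathbb{N}}$ be a sequence of real numbers, and define recursively $$x^{(n+1)}=\mathbb{P}_R\left[x^{(n)}+\beta^{(n)}K^*(y-Kx^{(n)})\right],\qquad n\in\mathbb{N}=\{0,1,2,\dots\}.$$ Assume that there exists $n_0$ such that (B1) $\sup\{\beta^{(n)}: n\in\mathbb{N}\}<\infty$ and $\inf\{\beta^{(n)}: n\in\mathbb{N}\}\geq 1$; (B2) $\beta^{(n)}\|K(x^{(n+1)}-x^{(n)})\|^2\leq r\,\|x^{(n+1)}-x^{(n)}\|^2$ for all $n\geq n_0$. Then the sequence $(x^{(n)})_{n\in\mathbb{N}}$ converges in the norm of $\ell_2(\Lambda)$ to a minimizer of $\mathcal{D}$ on $B_R$.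
   Context: $\Lambda$ is a countable (finite or infinite) index set; $\ell_p(\Lambda)$ denotes the space of real sequences $x=(x_\lambda)_{\lambda\in\Lambda}$ with finite norm $\|x\|_p=(\sum_{\lambda}|x_\lambda|^p)^{1/p}$, and $\|\cdot\|$ without subscript denotes the $\ell_2$-norm or the norm of $\mathcal{H}$. $B_R=\{x\in\ell_2(\Lambda): \|x\|_1\leq R\}$, and $\mathbb{P}_R(x)$ is the unique point of the closed convex set $B_R$ at minimal $\ell_2$-distance from $x\in\ell_2(\Lambda)$. $K^*$ is the adjoint of $K$. *)

(* Defs.v *)
From HB Require Import structures.
From mathcomp Require Import all_boot all_order all_algebra.
From mathcomp Require Import finmap.
From mathcomp Require Import all_classical all_reals all_analysis.
From mathcomp Require Import ring lra.

Set Implicit Arguments.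
Unset Strict Implicit.
Unset Printing Implicit Defensive.

Import Order.TTheory GRing.Theory Num.Theory.
Import numFieldNormedType.Exports.

Local Open Scope classical_set_scope.
Local Open Scope ring_scope.

(* Real Hilbert spaces: a complete norm that comes from an inner product. *)
HB.mixin Record isHilbert (R : realType) H & CompleteNormedModule R H := {
  inner : H -> H -> R;
  innerC : forall x y, inner x y = inner y x;
  innerPl : forall (a : R) x y z,
    inner (a *: x + y) z = a * inner x z + inner y z;
  inner_norm : forall x, inner x x = `|x| ^+ 2 }.

#[short(type="hilbertType")]
HB.structure Definition Hilbert (R : realType) :=
  {H of isHilbert R H & CompleteNormedModule R H}.

Definition is_separable (T : topologicalType) :=
  exists2 D : set T, countable D & dense D.

(* Extended-real valued, so that [opnorm f < +oo] says that f is bounded. *)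
Definition opnorm (R : realType) (U V : normedModType R) (f : U -> V) : \bar R :=
  ereal_sup [set (`|f u|)%:E | u in [set u | `|u| <= 1]].

(* The Hilbert adjoint: adjoint f v is the w with <f u, v> = <u, w> for all u.
   Such a w exists for bounded linear f ([adjointP]) and is unique ([inner_inj]). *)
Definition adjoint (R : realType) (U V : hilbertType R) (f : U -> V)
    (v : V) : U :=
  xget 0 [set w | forall u, inner (f u) v = inner u w].

Definition is_minimizer (R : realType) (T : Type) (D : T -> R) (B : set T)
    (x : T) :=
  B x /\ forall z, B z -> D x <= D z.

(* Metric projection onto B; well defined when B is nonempty, closed and convex
   ([projP], [is_projE]), in particular for l1 balls ([proj_l1ballP]). *)
Definition metric_proj (R : realType) (U : normedModType R) (B : set U) (x : U) : U :=
  xget x [set p | is_minimizer (fun z => `|x - z|) B p].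

(* The value is +oo when x is not in l_p. *)
Definition lpnorm (R : realType) (L : choiceType) (p : R) (x : L -> R) : \bar R :=
  ((\esum_(i in [set: L]) (`|x i| `^ p)%:E) `^ p^-1)%E.

Section real_sums.
Context {R : realType} {L : choiceType}.
Implicit Types f g a b : L -> R.

Let S f : \bar R := (\esum_(i in [set: L]) (f i)%:E)%E.

(* Meaningful only for absolutely summable f: positive part minus negative part. *)
Definition rsum f : R :=
  fine (\esum_(i in [set: L]) (Num.max (f i) 0)%:E)
  - fine (\esum_(i in [set: L]) (Num.max (- f i) 0)%:E).

Lemma nesum_ge0 f : (forall i, 0 <= f i) -> (0 <= S f)%E.
Proof. by move=> f0; apply: esum_ge0 => i _; rewrite lee_fin. Qed.

Lemma nesum_fin f : (forall i, 0 <= f i) -> (S f < +oo)%E -> S f \is a fin_num.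
Proof. by move=> f0 foo; rewrite ge0_fin_numE// nesum_ge0. Qed.

Lemma nesumD f g : (forall i, 0 <= f i) -> (forall i, 0 <= g i) ->
  S (fun i => f i + g i) = (S f + S g)%E.
Proof. by move=> f0 g0; rewrite /S -esumD// => i _; rewrite lee_fin. Qed.

Lemma le_nesum f g : (forall i, f i <= g i) -> (S f <= S g)%E.
Proof. by move=> fg; apply: le_esum => i _; rewrite lee_fin. Qed.

Lemma le_nesum_fin f g : (forall i, f i <= g i) -> (S g < +oo)%E -> (S f < +oo)%E.
Proof. by move=> fg; apply: le_lt_trans; exact: le_nesum. Qed.

Lemma nesum_lty_D f g : (forall i, 0 <= f i) -> (forall i, 0 <= g i) ->
  (S f < +oo)%E -> (S g < +oo)%E -> (S (fun i => (f i + g i)%R) < +oo)%E.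
Proof. by move=> f0 g0 foo goo; rewrite nesumD// lte_add_pinfty. Qed.

Lemma nesum0 : S (fun=> 0) = 0%E.
Proof. by rewrite /S esum1. Qed.

Lemma nesumZ (c : R) f : 0 <= c -> S (fun i => c * f i) = (c%:E * S f)%E.
Proof.
rewrite le_eqVlt => /predU1P[<-|c0].
  rewrite mul0e -[RHS]nesum0; congr S; apply/funext => i; exact: mul0r.
rewrite /S /esum -ereal_sup_pZl//; congr ereal_sup; apply/seteqP; split.
  move=> _ [A [finA AT] <-] /=.
  exists (\sum_(x \in A) (f x)%:E)%E; first by exists A.
  rewrite !fsumEFin// -EFinM; congr EFin.
  by rewrite !fsbig_finite//= mulr_sumr.
move=> _ [_ [A [finA AT] <-] <-] /=.
exists A => //.
rewrite !fsumEFin// -EFinM; congr EFin.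
by rewrite !fsbig_finite//= mulr_sumr.
Qed.

Lemma nesum_ge_fsum f (s : {fset L}) : (forall i, 0 <= f i) ->
  ((\sum_(i <- s) f i)%R%:E <= S f)%E.
Proof.
move=> f0; apply: esum_ge; exists [set` s]; first by split.
by rewrite fsumEFin// fsbig_finite//= set_fsetK.
Qed.

Lemma nesum_le f (c : \bar R) : (forall s : {fset L}, (\sum_(i <- s) f i)%:E <= c)%E ->
  (S f <= c)%E.
Proof.
move=> h; apply: ge_ereal_sup => _ [A [finA _] <-].
by rewrite fsumEFin// fsbig_finite.
Qed.

Lemma rsumB a b : (forall i, 0 <= a i) -> (forall i, 0 <= b i) ->
  (S a < +oo)%E -> (S b < +oo)%E ->
  rsum (fun i => a i - b i) = fine (S a) - fine (S b).
Proof.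
move=> a0 b0 aoo boo; rewrite /rsum.
set p := fun i => Num.max (a i - b i) 0; set n := fun i => Num.max (- (a i - b i)) 0.
rewrite -/(S p) -/(S n).
have p0 i : 0 <= p i by rewrite le_max lexx orbT.
have n0 i : 0 <= n i by rewrite le_max lexx orbT.
have poo : (S p < +oo)%E.
  by apply: le_nesum_fin aoo => i; rewrite /p ge_max a0 andbT lerBlDr lerDl.
have noo : (S n < +oo)%E.
  by apply: le_nesum_fin boo => i; rewrite /n ge_max b0 andbT opprB lerBlDr lerDl.
have : (S p + S b = S n + S a)%E.
  rewrite -!nesumD//; congr S; apply/funext => i; rewrite /p /n.
  by case: (leP (a i - b i) 0); case: (leP (- (a i - b i)) 0); lra.
move/(congr1 fine); rewrite !fineD ?nesum_fin//.
by move=> h; lra.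
Qed.

Lemma rsum_ge0E f : (forall i, 0 <= f i) -> (S f < +oo)%E -> rsum f = fine (S f).
Proof.
move=> f0 foo.
have -> : rsum f = rsum (fun i => f i - (fun=> 0) i).
  by congr rsum; apply/funext => i; rewrite subr0.
by rewrite rsumB// ?nesum0// subr0.
Qed.

Lemma summable_parts f : (S (fun i => `|f i|%R) < +oo)%E ->
  exists p n : L -> R, [/\ forall i, 0 <= p i, forall i, 0 <= n i,
    (S p < +oo)%E, (S n < +oo)%E & f = fun i => p i - n i].
Proof.
move=> foo; exists (fun i => Num.max (f i) 0), (fun i => Num.max (- f i) 0).
split=> [i|i|||].
- by rewrite le_max lexx orbT.
- by rewrite le_max lexx orbT.
- by apply: le_nesum_fin foo => i; rewrite ge_max normr_ge0 andbT ler_norm.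
- by apply: le_nesum_fin foo => i; rewrite ge_max normr_ge0 andbT -normrN ler_norm.
- by apply/funext => i; case: (leP (f i) 0); case: (leP (- f i) 0); lra.
Qed.

Lemma rsumD f g : (S (fun i => `|f i|%R) < +oo)%E -> (S (fun i => `|g i|%R) < +oo)%E ->
  rsum (fun i => f i + g i) = rsum f + rsum g.
Proof.
move=> /summable_parts[p [n [p0 n0 poo noo ->]]].
move=> /summable_parts[p' [n' [p'0 n'0 p'oo n'oo ->]]].
have -> : (fun i => p i - n i + (p' i - n' i)) =
          (fun i => (p i + p' i) - (n i + n' i)) by apply/funext => i; ring.
rewrite !rsumB//; try by move=> i; rewrite addr_ge0.
- by rewrite !nesumD// !fineD ?nesum_fin//; ring.
- exact: nesum_lty_D.
- exact: nesum_lty_D.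
Qed.

Lemma rsumZ c f : (S (fun i => `|f i|%R) < +oo)%E ->
  rsum (fun i => c * f i) = c * rsum f.
Proof.
move=> /summable_parts[p [n [p0 n0 poo noo ->]]].
have Zoo d h : 0 <= d -> (forall i, 0 <= h i) -> (S h < +oo)%E ->
    (S (fun i => (d * h i)%R) < +oo)%E.
  move=> d0 h0 hoo; rewrite nesumZ//.
  by rewrite -[S h]fineK ?nesum_fin// -EFinM ltry.
have [c0|c0] := leP 0 c.
  have -> : (fun i => c * (p i - n i)) = (fun i => c * p i - c * n i).
    by apply/funext => i; ring.
  rewrite !rsumB// ?Zoo//; try by move=> i; rewrite mulr_ge0.
  by rewrite !nesumZ// !fineM ?nesum_fin//= mulrBr.
have c'0 : 0 <= - c by rewrite oppr_ge0 ltW.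
have -> : (fun i => c * (p i - n i)) = (fun i => (- c) * n i - (- c) * p i).
  by apply/funext => i; ring.
rewrite !rsumB// ?Zoo//; try by move=> i; rewrite mulr_ge0.
by rewrite !nesumZ// !fineM ?nesum_fin//=; ring.
Qed.

End real_sums.

Section ell2_pred.
Context {R : realType} {L : choiceType}.
Implicit Types x y : L -> R.

Definition is_ell2 : {pred L -> R} := fun x => (lpnorm 2 x < +oo)%E.

Lemma lpnorm2E x :
  lpnorm 2 x = ((\esum_(i in [set: L]) (x i ^+ 2)%:E) `^ 2^-1)%E.
Proof.
congr (_ `^ _)%E; apply: eq_esum => i _.
by rewrite powR_mulrn// real_normK// num_real.
Qed.

Lemma is_ell2E x :
  (x \in is_ell2) = (\esum_(i in [set: L]) (x i ^+ 2)%:E < +oo)%E.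
Proof.
rewrite unfold_in lpnorm2E; apply/idP/idP; last exact: poweR_lty.
by apply: lty_poweRy; rewrite invr_eq0.
Qed.

Lemma is_ell2_submod_closed : submod_closed is_ell2.
Proof.
split=> [|a x y]; first by rewrite is_ell2E esum1// => i _; rewrite expr0n.
rewrite !is_ell2E => xoo yoo.
pose b i := (2 * a ^+ 2) * x i ^+ 2 + 2 * y i ^+ 2.
apply: (@le_nesum_fin _ _ _ b) => [i|].
  rewrite /b !fctE -[a *: x i]/(a * x i).
  by have := sqr_ge0 (a * x i - y i); lra.
have Zoo (c : R) (z : L -> R) : 0 <= c ->
    (\esum_(i in [set: L]) (z i ^+ 2)%:E < +oo)%E ->
    (\esum_(i in [set: L]) (c * z i ^+ 2)%:E < +oo)%E.
  move=> c0 zoo; rewrite (@nesumZ R L c (fun i => z i ^+ 2))//.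
  rewrite -[X in (_ * X)%E]fineK -?EFinM ?ltry//.
  by apply: nesum_fin => // i; rewrite sqr_ge0.
apply: nesum_lty_D => [i|i||].
- by rewrite mulr_ge0 ?sqr_ge0// mulr_ge0 ?sqr_ge0.
- by rewrite mulr_ge0 ?sqr_ge0.
- by apply: Zoo => //; rewrite mulr_ge0 ?sqr_ge0.
- exact: Zoo.
Qed.

HB.instance Definition _ :=
  GRing.isSubmodClosed.Build R (L -> R) is_ell2 is_ell2_submod_closed.

End ell2_pred.

Record ell2 (R : realType) (L : choiceType) :=
  Ell2 { ell2_val :> L -> R ; _ : ell2_val \in is_ell2 }.

HB.instance Definition _ R L := [isSub for @ell2_val R L].
HB.instance Definition _ R L := [Choice of ell2 R L by <:].
HB.instance Definition _ R L := [SubChoice_isSubLmodule of ell2 R L by <:].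

Section ell2_hilbert.
Context {R : realType} {L : choiceType}.
Implicit Types (x y z : ell2 R L) (a : R).

Lemma ell2P x y : (forall i, x i = y i) -> x = y.
Proof. by move=> xy; apply/val_inj/funext. Qed.

Lemma ell2_fin x : (\esum_(i in [set: L]) (x i ^+ 2)%:E < +oo)%E.
Proof. by case: x => x xP; rewrite -is_ell2E. Qed.

Lemma ell2_valD x y i : (x + y) i = x i + y i. Proof. by []. Qed.
Lemma ell2_valB x y i : (x - y) i = x i - y i. Proof. by []. Qed.
Lemma ell2_valZ a x i : (a *: x) i = a * x i. Proof. by []. Qed.

Definition ell2_inner x y : R := rsum (fun i => x i * y i).

Lemma ell2_inner_summable x y :
  (\esum_(i in [set: L]) (`|x i * y i|%R)%:E < +oo)%E.
Proof.
apply: (@le_nesum_fin _ _ _ (fun i => x i ^+ 2 + y i ^+ 2)) => [i|].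
  rewrite normrM -[x i ^+ 2]real_normK ?num_real// -[y i ^+ 2]real_normK ?num_real//.
  have := sqr_ge0 (`|x i| - `|y i|).
  by have := normr_ge0 (x i); have := normr_ge0 (y i); nra.
by apply: nesum_lty_D (ell2_fin x) (ell2_fin y) => i; exact: sqr_ge0.
Qed.

Lemma ell2_innerC x y : ell2_inner x y = ell2_inner y x.
Proof. by congr rsum; apply/funext => i; rewrite mulrC. Qed.

Lemma ell2_innerPl a x y z :
  ell2_inner (a *: x + y) z = a * ell2_inner x z + ell2_inner y z.
Proof.
have zx := ell2_inner_summable (a *: x) z.
rewrite {2}/ell2_inner -(@rsumZ _ _ a (fun i => x i * z i)); last first.
  exact: ell2_inner_summable.
have -> : (fun i => a * (x i * z i)) = (fun i => (a *: x) i * z i).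
  by apply/funext => i; rewrite ell2_valZ mulrA.
rewrite -(@rsumD _ _ (fun i => (a *: x) i * z i) (fun i => y i * z i))//.
- by congr rsum; apply/funext => i; rewrite ell2_valD mulrDl.
- exact: ell2_inner_summable.
Qed.

Lemma ell2_inner_sqr x :
  ell2_inner x x = fine (\esum_(i in [set: L]) (x i ^+ 2)%:E).
Proof.
rewrite -(@rsum_ge0E _ _ (fun i => x i ^+ 2)) => [//|i|]; first exact: sqr_ge0.
exact: ell2_fin.
Qed.

Lemma ell2_inner_ge0 x : 0 <= ell2_inner x x.
Proof. by rewrite ell2_inner_sqr fine_ge0// nesum_ge0// => i; exact: sqr_ge0. Qed.

Lemma ell2_inner_ge_coord x i : x i ^+ 2 <= ell2_inner x x.
Proof.
rewrite ell2_inner_sqr -lee_fin fineK; last first.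
  by apply: nesum_fin (ell2_fin x) => j; exact: sqr_ge0.
have := @nesum_ge_fsum R L (fun j => x j ^+ 2) [fset i]%fset (fun j => sqr_ge0 _).
by rewrite big_seq_fset1.
Qed.

Lemma ell2_inner_eq0 x : ell2_inner x x = 0 -> x = 0.
Proof.
move=> x0; apply: ell2P => i; apply/eqP; rewrite -sqrf_eq0 eq_le sqr_ge0 andbT.
by rewrite -x0 ell2_inner_ge_coord.
Qed.

Definition ell2_norm x : R := fine (lpnorm 2 x).

Lemma ell2_normE x : ell2_norm x = Num.sqrt (ell2_inner x x).
Proof.
rewrite /ell2_norm lpnorm2E fine_poweR powR12_sqrt; first by rewrite ell2_inner_sqr.
by rewrite -ell2_inner_sqr ell2_inner_ge0.
Qed.

Lemma ell2_innerDl x y z : ell2_inner (x + y) z = ell2_inner x z + ell2_inner y z.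
Proof. by have := ell2_innerPl 1 x y z; rewrite scale1r mul1r. Qed.

Lemma ell2_inner0l z : ell2_inner 0 z = 0.
Proof. by have := ell2_innerDl 0 0 z; rewrite addr0; lra. Qed.

Lemma ell2_innerZl a x z : ell2_inner (a *: x) z = a * ell2_inner x z.
Proof. by have := ell2_innerPl a x 0 z; rewrite addr0 ell2_inner0l addr0. Qed.

Lemma ell2_innerDr x y z : ell2_inner x (y + z) = ell2_inner x y + ell2_inner x z.
Proof. by rewrite ell2_innerC ell2_innerDl !(ell2_innerC x). Qed.

Lemma ell2_innerZr a x y : ell2_inner x (a *: y) = a * ell2_inner x y.
Proof. by rewrite ell2_innerC ell2_innerZl ell2_innerC. Qed.

Lemma ell2_inner_le x y : ell2_inner x y <= ell2_norm x * ell2_norm y.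
Proof.
have [->|x0] := eqVneq x 0.
  by rewrite ell2_inner0l mulr_ge0// ell2_normE sqrtr_ge0.
have [->|y0] := eqVneq y 0.
  by rewrite ell2_innerC ell2_inner0l mulr_ge0// ell2_normE sqrtr_ge0.
have pos z : z != 0 -> 0 < ell2_norm z.
  move=> z0; rewrite ell2_normE sqrtr_gt0 lt_neqAle ell2_inner_ge0 andbT eq_sym.
  by apply: contra z0 => /eqP/ell2_inner_eq0 ->.
have sq z : ell2_inner z z = ell2_norm z ^+ 2.
  by rewrite ell2_normE sqr_sqrtr// ell2_inner_ge0.
have := ell2_inner_ge0 (ell2_norm y *: x + (- ell2_norm x) *: y).
rewrite !(ell2_innerDl, ell2_innerDr, ell2_innerZl, ell2_innerZr) !sq.
rewrite (ell2_innerC y x).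
have := mulr_gt0 (pos _ x0) (pos _ y0).
by move: (ell2_norm x) (ell2_norm y) (ell2_inner x y) => p q r pq h; nra.
Qed.

Lemma ell2_normD x y : ell2_norm (x + y) <= ell2_norm x + ell2_norm y.
Proof.
have n0 z : 0 <= ell2_norm z by rewrite ell2_normE sqrtr_ge0.
rewrite -(@ler_pXn2r _ 2)// ?nnegrE ?addr_ge0//.
rewrite {1}ell2_normE sqr_sqrtr ?ell2_inner_ge0//.
rewrite ell2_innerDl !ell2_innerDr (ell2_innerC y x).
have sq z : ell2_inner z z = ell2_norm z ^+ 2.
  by rewrite ell2_normE sqr_sqrtr// ell2_inner_ge0.
by rewrite !sq; have := ell2_inner_le x y; nra.
Qed.

Lemma ell2_normZ a x : ell2_norm (a *: x) = `|a| * ell2_norm x.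
Proof.
rewrite !ell2_normE ell2_innerZl ell2_innerZr mulrA -expr2 sqrtrM ?sqr_ge0//.
by rewrite sqrtr_sqr.
Qed.

Lemma ell2_norm0_eq0 x : ell2_norm x = 0 -> x = 0.
Proof.
rewrite ell2_normE => /eqP; rewrite sqrtr_eq0 => x0.
by apply: ell2_inner_eq0; apply/eqP; rewrite eq_le x0 ell2_inner_ge0.
Qed.

(* The norm of ell2 is [fine (lpnorm 2 x)], its inner product the sum of the
   x i * y i. *)
HB.instance Definition _ := isPointed.Build (ell2 R L) 0.
HB.instance Definition _ :=
  Lmodule_isNormed.Build R (ell2 R L) ell2_normD ell2_normZ ell2_norm0_eq0.

Lemma ell2_sqr_norm x : `|x| ^+ 2 = ell2_inner x x.
Proof.
by rewrite -[ `|x| ]/(ell2_norm x) ell2_normE sqr_sqrtr ?ell2_inner_ge0.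
Qed.

Lemma ell2_coord_le x i : `|x i| <= `|x|.
Proof.
rewrite -(@ler_pXn2r _ 2)// ?nnegrE// real_normK ?num_real// ell2_sqr_norm.
exact: ell2_inner_ge_coord.
Qed.

Lemma ell2_complete (F : set_system (ell2 R L)) :
  ProperFilter F -> cauchy F -> cvg F.
Proof.
move=> FF /cauchy_ballP Fc.
have coord i : cvg ((fun x : ell2 R L => x i) @ F).
  apply: cauchy_cvg; apply/cauchy_ballP => e e0.
  have := Fc e e0; rewrite !near_simpl => -[[A B]] /= [FA FB] AB.
  exists ((fun x => x i) @` A, (fun x => x i) @` B) => /=.
    by split; [apply: filterS FA|apply: filterS FB] => x ?; exists x.
  move=> [_ _] /= [[x Ax <-] [y By <-]] /=.
  have := AB (x, y) (conj Ax By); rewrite -!ball_normE/=.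
  by apply: le_lt_trans; rewrite -ell2_valB ell2_coord_le.
pose l i := lim ((fun x : ell2 R L => x i) @ F).
have key e : 0 < e -> F [set x : ell2 R L |
   (\esum_(i in [set: L]) ((x i - l i) ^+ 2)%:E <= (e ^+ 2)%:E)%E].
  move=> e0.
  have [[A B] /= [FA FB] AB] := Fc e e0.
  apply: filterS FA => x Ax; apply: nesum_le => s; rewrite lee_fin.
  have cs : (fun y : ell2 R L => \sum_(i <- s) (x i - y i) ^+ 2) @ F -->
            \sum_(i <- s) (x i - l i) ^+ 2.
    apply: cvg_big => [|i _]; first exact: add_continuous.
    rewrite expr2; under eq_fun do rewrite expr2.
    by apply: cvgM; apply: cvgB; [exact: cvg_cst|exact: coord|exact: cvg_cst|exact: coord].
  rewrite -(cvg_lim _ cs)//; apply: limr_le; first by apply/cvg_ex; eexists; exact: cs.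
  apply: filterS FB => y By.
  have := AB (x, y) (conj Ax By); rewrite -!ball_normE/= => /ltW xy.
  have : ell2_inner (x - y) (x - y) <= e ^+ 2.
    by rewrite -ell2_sqr_norm ler_pXn2r// ?nnegrE ?(ltW e0).
  apply: le_trans; rewrite ell2_inner_sqr -lee_fin fineK.
    by apply: (@nesum_ge_fsum _ _ (fun i => (x i - y i) ^+ 2)) => i; exact: sqr_ge0.
  by apply: nesum_fin (ell2_fin (x - y)) => i; exact: sqr_ge0.
have lP : l \in is_ell2.
  have [x xl] : exists x : ell2 R L,
     (\esum_(i in [set: L]) ((x i - l i) ^+ 2)%:E <= (1 ^+ 2)%:E)%E.
    by apply: (@filter_ex _ F); exact: key.
  have xlP : (ell2_val x - l) \in is_ell2.
    by rewrite is_ell2E (le_lt_trans xl)// ltry.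
  have -> : l = ell2_val x - (ell2_val x - l) by rewrite opprB addrC subrK.
  by apply: rpredB xlP; case: (x).
apply/cvg_ex; exists (Ell2 lP); apply/cvgrPdist_le => e e0.
have := key e e0; apply: filterS => x xl.
rewrite distrC -(@ler_pXn2r _ 2)// ?nnegrE ?(ltW e0)// ell2_sqr_norm.
rewrite ell2_inner_sqr -lee_fin fineK//.
by apply: nesum_fin (ell2_fin (x - Ell2 lP)) => i; exact: sqr_ge0.
Qed.

HB.instance Definition _ := Uniform_isComplete.Build (ell2 R L) ell2_complete.

Lemma ell2_inner_norm x : ell2_inner x x = `|x| ^+ 2.
Proof. by rewrite ell2_sqr_norm. Qed.

HB.instance Definition _ := isHilbert.Build R (ell2 R L)
  ell2_innerC ell2_innerPl ell2_inner_norm.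

End ell2_hilbert.

Definition l1ball (R : realType) (L : choiceType) (r : R) : set (ell2 R L) :=
  [set x | (lpnorm 1 x <= r%:E)%E].

Definition discrepancy (R : realType) (U V : normedModType R) (K : U -> V)
    (y : V) (x : U) : R :=
  `|K x - y| ^+ 2.

Section hilbert_theory.
Context {R : realType} {H : hilbertType R}.
Implicit Types (u v w x y z : H) (a : R).

Lemma innerDl x y z : inner (x + y) z = inner x z + inner y z.
Proof. by have := innerPl 1 x y z; rewrite scale1r mul1r. Qed.

Lemma inner0l z : inner 0 z = 0.
Proof. by have := innerDl 0 0 z; rewrite addr0; lra. Qed.

Lemma innerZl a x z : inner (a *: x) z = a * inner x z.
Proof. by have := innerPl a x 0 z; rewrite addr0 inner0l addr0. Qed.

Lemma innerNl x z : inner (- x) z = - inner x z.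
Proof. by rewrite -scaleN1r innerZl mulN1r. Qed.

Lemma innerDr x y z : inner x (y + z) = inner x y + inner x z.
Proof. by rewrite innerC innerDl !(innerC x). Qed.

Lemma innerZr a x y : inner x (a *: y) = a * inner x y.
Proof. by rewrite innerC innerZl innerC. Qed.

Lemma innerNr x y : inner x (- y) = - inner x y.
Proof. by rewrite innerC innerNl innerC. Qed.

Definition innerE := (innerDl, innerDr, innerNl, innerNr, innerZl, innerZr).

Lemma hilbert_normD x y : `|x + y| ^+ 2 = `|x| ^+ 2 + 2 * inner x y + `|y| ^+ 2.
Proof. by rewrite -!inner_norm !innerE (innerC y x); ring. Qed.

Lemma hilbert_normB x y : `|x - y| ^+ 2 = `|x| ^+ 2 - 2 * inner x y + `|y| ^+ 2.
Proof. by rewrite hilbert_normD normrN innerNr; ring. Qed.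

Lemma inner_inj x y : (forall u, inner u x = inner u y) -> x = y.
Proof.
move=> xy; apply/eqP; rewrite -subr_eq0 -normr_eq0 -sqrf_eq0 -inner_norm.
by rewrite innerDr innerNr xy subrr.
Qed.

Lemma inner_le x y : inner x y <= `|x| * `|y|.
Proof.
have [->|x0] := eqVneq x 0; first by rewrite inner0l normr0 mul0r.
have [->|y0] := eqVneq y 0; first by rewrite innerC inner0l normr0 mulr0.
have xy : 0 < `|x| * `|y| by rewrite mulr_gt0// normr_gt0.
have := sqr_ge0 (`| `|y| *: x - `|x| *: y |).
rewrite hilbert_normB !normrZ !normr_id innerZl innerZr.
by move: xy; move: `|x| `|y| (inner x y) => p q r pq h; nra.
Qed.

Lemma normr_inner_le x y : `|inner x y| <= `|x| * `|y|.
Proof.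
by rewrite ler_norml inner_le andbT lerNl -innerNl (le_trans (inner_le _ _))// normrN.
Qed.

Definition cvx_set (B : set H) :=
  forall u v t, 0 <= t <= 1 -> B u -> B v -> B (t *: u + (1 - t) *: v).

(* Parallelogram law around x, for the midpoint of u and v. *)
Lemma mid_norm x u v : `|u - v| ^+ 2 =
  2 * `|x - u| ^+ 2 + 2 * `|x - v| ^+ 2
  - 4 * `|x - (2^-1 *: u + (1 - 2^-1) *: v)| ^+ 2.
Proof.
rewrite -!inner_norm !innerE (innerC u x) (innerC v x) (innerC v u).
by field.
Qed.

Lemma is_projE x B p q : cvx_set B -> is_minimizer (fun z => `|x - z|) B p ->
  is_minimizer (fun z => `|x - z|) B q -> p = q.
Proof.
move=> cB [Bp minp] [Bq minq].
have pq : `|x - p| = `|x - q| by apply/eqP; rewrite eq_le minp// minq.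
have Bm : B (2^-1 *: p + (1 - 2^-1) *: q) by apply: cB => //; lra.
have := minp _ Bm; rewrite -(@ler_pXn2r _ 2)// ?nnegrE// => h.
have := mid_norm x p q; rewrite -pq => e.
apply/eqP; rewrite -subr_eq0 -normr_eq0 -sqrf_eq0 eq_le sqr_ge0 andbT.
by rewrite e; lra.
Qed.

Lemma proj_exists x B : B !=set0 -> closed B -> cvx_set B ->
  exists p, is_minimizer (fun z => `|x - z|) B p.
Proof.
move=> [b Bb] clB cB.
pose D := [set `|x - z| ^+ 2 | z in B].
have D0 : D !=set0 by exists (`|x - b| ^+ 2); exists b.
have lbD : has_lbound D by exists 0 => _ [z _ <-]; exact: sqr_ge0.
have infD : has_inf D by [].
pose d := inf D.
have dle z : B z -> d <= `|x - z| ^+ 2 by move=> Bz; apply: ge_inf => //; exists z.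
have /choice[u uP] : forall n : nat, exists z, B z /\ `|x - z| ^+ 2 <= d + n.+1%:R^-1.
  move=> n; have n0 : 0 < n.+1%:R^-1 :> R by rewrite invr_gt0.
  have [_ [z Bz <-] zd] := inf_adherent n0 infD.
  by exists z; split=> //; exact: ltW.
have cu : cauchy (u @ \oo).
  apply: cauchy_exP => e e0.
  have e20 : 0 < e ^+ 2 / 4 by rewrite divr_gt0// exprn_gt0.
  have [N _ Ne] := near_infty_natSinv_lt (PosNum e20).
  exists (u N); exists N => // n /= Nn.
  rewrite -ball_normE/= -(@ltr_pXn2r _ 2)// ?nnegrE ?(ltW e0)//.
  rewrite (mid_norm x).
  have := Ne N (leqnn N); have := Ne n Nn => /=.
  have [BN uN] := uP N; have [Bn un] := uP n.
  have /dle : B (2^-1 *: u N + (1 - 2^-1) *: u n) by apply: cB => //; lra.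
  move: uN un; move: (_ ^+ 2) (`|x - u N| ^+ 2) (`|x - u n| ^+ 2) => q p1 p2.
  move: (e ^+ 2) (N.+1%:R^-1) (n.+1%:R^-1) => e2 s t.
  by lra.
have /cvg_ex[p up] : cvg (u @ \oo) by exact: cauchy_cvg.
exists p; split.
  have uB : \forall n \near \oo, B (u n) by apply: nearW => n; have [] := uP n.
  exact: (@closed_cvg _ _ _ _ u B clB uB p up).
move=> z Bz; rewrite -(@ler_pXn2r _ 2)// ?nnegrE//.
apply: le_trans (dle _ Bz).
apply/ler_addgt0Pr => e e0.
have cx : (fun n => `|x - u n| ^+ 2) @ \oo --> `|x - p| ^+ 2.
  rewrite expr2; under eq_fun do rewrite expr2.
  have cn : (fun n => `|x - u n|) @ \oo --> `|x - p|.
    by apply: cvg_norm; apply: cvgB => //; exact: cvg_cst.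
  exact: cvgM.
rewrite -(cvg_lim _ cx)//; apply: limr_le.
  by apply/cvg_ex; eexists; exact: cx.
have [N _ Ne] := near_infty_natSinv_lt (PosNum e0).
exists N => // n /= Nn.
have [_ /le_trans] := uP n; apply; rewrite lerD2l ltW//.
exact: Ne.
Qed.

Lemma projP x B : B !=set0 -> closed B -> cvx_set B ->
  is_minimizer (fun z => `|x - z|) B (metric_proj B x).
Proof. by move=> B0 clB cB; apply: xgetPex; exact: proj_exists. Qed.

End hilbert_theory.

Lemma quad_ge0 (R : realFieldType) (a b : R) : 0 <= b ->
  (forall t, 0 <= t ^+ 2 * b - 2 * t * a) -> a = 0.
Proof.
move=> b0 /(_ (a / (b + 1))) h.
have b1 : b + 1 != 0 by rewrite gt_eqF// ltr_wpDl.
have : 0 <= (a / (b + 1)) ^+ 2 * (b - 2 * (b + 1)).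
  suff -> : (a / (b + 1)) ^+ 2 * (b - 2 * (b + 1)) =
    (a / (b + 1)) ^+ 2 * b - 2 * (a / (b + 1)) * a by [].
  by field.
have := sqr_ge0 (a / (b + 1)); set s := (_ ^+ 2) => s0 hs.
have /eqP : s = 0 by nra.
by rewrite sqrf_eq0 mulf_eq0 invr_eq0 (negbTE b1) orbF => /eqP.
Qed.

Section adjoint_theory.
Context {R : realType}.

Lemma opnorm_bound (U V : normedModType R) (f : {linear U -> V}) u :
  (opnorm f < +oo)%E -> `|f u| <= fine (opnorm f) * `|u|.
Proof.
move=> foo.
have [->|u0] := eqVneq u 0; first by rewrite linear0 !normr0 mulr0.
have nu : 0 < `|u| by rewrite normr_gt0.
have fge w : `|w| <= 1 -> ((`|f w|)%:E <= opnorm f)%E.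
  by move=> w1; apply: ereal_sup_ubound; exists w.
have fin : opnorm f \is a fin_num.
  by rewrite ge0_fin_numE// (le_trans _ (fge 0 _)) ?normr0 ?ler01// lee_fin.
have := fge (`|u|^-1 *: u).
rewrite normrZ ger0_norm ?invr_ge0// mulVf ?gt_eqF// lexx => /(_ isT).
rewrite -[opnorm f]fineK// lee_fin linearZ/= normrZ ger0_norm ?invr_ge0//.
by rewrite mulrC ler_pdivrMr.
Qed.

Lemma opnorm_continuous (U V : normedModType R) (f : {linear U -> V}) :
  (opnorm f < +oo)%E -> continuous f.
Proof.
move=> foo; apply/linear_bounded_continuous/bounded_funP => r.
exists (`|fine (opnorm f)| * `|r|) => x xr.
apply: (le_trans (opnorm_bound _ foo)).
apply: (@le_trans _ _ (`|fine (opnorm f)| * `|x|)).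
  by rewrite ler_wpM2r// ler_norm.
by rewrite ler_wpM2l// (le_trans xr)// ler_norm.
Qed.

Lemma riesz (U : hilbertType R) (f : {linear U -> R^o}) : continuous f ->
  exists w, forall u, f u = inner u w.
Proof.
move=> fc.
have [[u0 fu0]|f0] := pselect (exists u, f u != 0); last first.
  exists 0 => u; rewrite innerC inner0l; apply/eqP.
  by apply: contrapT => fu; apply: f0; exists u; apply/negP.
pose N : set U := [set u | f u = 0].
have N0 : N !=set0 by exists 0; exact: linear0.
have clN : closed N.
  rewrite (_ : N = f @^-1` [set 0]); last by [].
  by apply: (proj1 (continuous_closedP _) fc); exact: closed_eq.
have cN : cvx_set N.
  by move=> u v t _ Nu Nv; rewrite /N/= linearD !linearZ/= Nu Nv !scaler0 addr0.
have [Np minp] := projP u0 N0 clN cN.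
set p := metric_proj N u0 in Np minp.
pose e := u0 - p.
have fe : f e = f u0 by rewrite /e linearB/= Np subr0.
have orth k : N k -> inner e k = 0.
  move=> Nk; apply: (@quad_ge0 _ _ (`|k| ^+ 2)) => [|t]; first exact: sqr_ge0.
  have Npk : N (p + t *: k) by rewrite /N/= linearD linearZ/= Np Nk scaler0 addr0.
  have := minp _ Npk; rewrite -(@ler_pXn2r _ 2)// ?nnegrE//.
  have -> : u0 - (p + t *: k) = e - t *: k by rewrite opprD addrA.
  rewrite -/e (hilbert_normB e) normrZ exprMn real_normK ?num_real//.
  by rewrite innerZr; lra.
have e0 : e != 0 by apply: contra fu0 => /eqP ee; rewrite -fe ee linear0.
have ne : `|e| ^+ 2 != 0 by rewrite sqrf_eq0 normr_eq0.
have fe0 : f e != 0 by rewrite fe.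
exists ((f e / `|e| ^+ 2) *: e) => u.
have /orth : N (u - (f u / f e) *: e).
  by rewrite /N/= linearB linearZ/= /GRing.scale/= divfK// subrr.
rewrite innerDr innerNr innerZr inner_norm innerZr (innerC e u) => /eqP.
rewrite subr_eq0 => /eqP ->.
by field; rewrite fe0 -sqrf_eq0 ne.
Qed.

Lemma adjointP (U V : hilbertType R) (f : {linear U -> V}) u v :
  (opnorm f < +oo)%E -> inner (f u) v = inner u (adjoint f v).
Proof.
move=> foo.
pose g u : R^o := inner (f u) v.
have glin : linear g.
  by move=> a x y; rewrite /g linearP innerPl.
pose G : {linear U -> R^o} :=
  HB.pack g (GRing.isLinear.Build R U R^o *:%R g glin).
have gc : continuous G.
  apply/linear_bounded_continuous/bounded_funP => r.
  exists (`|fine (opnorm f)| * `|r| * `|v|) => x xr.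
  apply: (le_trans (normr_inner_le _ _)); rewrite ler_wpM2r//.
  apply: (le_trans (opnorm_bound _ foo)).
  apply: (@le_trans _ _ (`|fine (opnorm f)| * `|x|)).
    by rewrite ler_wpM2r// ler_norm.
  by rewrite ler_wpM2l// (le_trans xr)// ler_norm.
have [w wP] := riesz gc.
have : [set w | forall u, inner (f u) v = inner u w] (adjoint f v).
  by apply: xgetPex; exists w => x; rewrite -wP.
exact.
Qed.

End adjoint_theory.

Lemma dist_le_continuous (R : realType) (V W : normedModType R) (f : V -> W) :
  (forall x z, `|f x - f z| <= `|x - z|) -> continuous f.
Proof.
move=> fle x; apply/cvgrPdist_le => e e0.
have /cvgrPdist_le/(_ e e0) : (id : V -> V) @ x --> x by exact: cvg_id.
by apply: filterS => z; apply: le_trans.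
Qed.

Section l1ball_theory.
Context {R : realType} {L : choiceType}.

Lemma l1ballE (r : R) :
  l1ball r = [set x : ell2 R L | (\esum_(i in [set: L]) (`|x i|)%:E <= r%:E)%E].
Proof.
have lpE (x : ell2 R L) : lpnorm 1 x = (\esum_(i in [set: L]) (`|x i|)%:E)%E.
  rewrite /lpnorm invr1 poweRe1; last by apply: esum_ge0 => i _; rewrite lee_fin powR_ge0.
  by apply: eq_esum => i _; rewrite powRr1.
by apply/seteqP; split=> x; rewrite /l1ball /= lpE.
Qed.

Lemma l1ball_n0 (r : R) : 0 <= r -> (l1ball r : set (ell2 R L)) !=set0.
Proof.
move=> r0; exists 0; rewrite l1ballE /=.
rewrite esum1; first by rewrite lee_fin.
by move=> i _; congr EFin; exact: normr0.
Qed.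

Lemma l1ball_cvx (r : R) : cvx_set (l1ball r : set (ell2 R L)).
Proof.
rewrite l1ballE => u v t /andP[t0 t1] /= ur vr.
have t1' : 0 <= 1 - t by rewrite subr_ge0.
pose b i := t * `|u i| + (1 - t) * `|v i|.
apply: (@le_trans _ _ (\esum_(i in [set: L]) (b i)%:E)%E).
  apply: le_nesum => i; apply: (le_trans (ler_normD (t * u i) ((1 - t) * v i))).
  by rewrite !normrM (ger0_norm t0) (ger0_norm t1').
rewrite (@nesumD _ _ (fun i => t * `|u i|) (fun i => (1 - t) * `|v i|)).
- rewrite (@nesumZ _ _ t (fun i => `|u i|))//.
  rewrite (@nesumZ _ _ (1 - t) (fun i => `|v i|))//.
  have -> : r%:E = (t%:E * r%:E + (1 - t)%:E * r%:E)%E.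
    by rewrite -!EFinM -EFinD; congr EFin; ring.
  by apply: leeD; apply: lee_pmul => //; apply: nesum_ge0.
- by move=> i; rewrite mulr_ge0.
- by move=> i; rewrite mulr_ge0.
Qed.

Lemma l1ball_closed (r : R) : closed (l1ball r : set (ell2 R L)).
Proof.
rewrite l1ballE.
have -> : [set x : ell2 R L | (\esum_(i in [set: L]) (`|x i|)%:E <= r%:E)%E] =
    \bigcap_(s in [set: {fset L}])
      ((fun x : ell2 R L => \sum_(i <- s) `|x i|) @^-1` [set t | t <= r]).
  apply/seteqP; split=> x /= h.
    move=> s _ /=; rewrite -lee_fin; apply: le_trans h.
    by apply: (@nesum_ge_fsum _ _ (fun i => `|x i|)).
  by apply: nesum_le => s; rewrite lee_fin; exact: h.
apply: closed_bigI => s _; apply: (proj1 (continuous_closedP _)); last exact: closed_le.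
have coordc i : continuous (fun x : ell2 R L => x i).
  by apply: dist_le_continuous => x z; exact: (ell2_coord_le (x - z) i).
elim: (enum_fset s) => [|i s' ih].
  rewrite (_ : (fun _ => _) = cst 0); first exact: cst_continuous.
  by apply/funext => x; rewrite big_nil.
rewrite (_ : (fun _ => _) =
    (fun x : ell2 R L => `|x i|) \+ (fun x : ell2 R L => \sum_(j <- s') `|x j|)).
  move=> x; apply: (@continuousD R R^o); last exact: ih.
  by apply: (@continuous_comp _ _ _ (fun x : ell2 R L => x i)); [exact: coordc|exact: norm_continuous].
by apply/funext => x; rewrite big_cons.
Qed.

Lemma proj_l1ballP (r : R) (x : ell2 R L) : 0 <= r ->
  is_minimizer (fun z => `|x - z|) (l1ball r) (metric_proj (l1ball r) x).
Proof.
by move=> r0; apply: projP; [exact: l1ball_n0|exact: l1ball_closed|exact: l1ball_cvx].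
Qed.

End l1ball_theory.

(* A point is a global minimizer of the discrepancy iff the gradient vanishes. *)
Lemma discrepancy_global_minimizerP (R : realType) (U V : hilbertType R)
    (K : {linear U -> V}) (y : V) (x : U) : (opnorm K < +oo)%E ->
  is_minimizer (discrepancy K y) [set: U] x <-> adjoint K (y - K x) = 0.
Proof.
move=> Koo.
have DE h : discrepancy K y (x + h) =
    discrepancy K y x - 2 * inner h (adjoint K (y - K x)) + `|K h| ^+ 2.
  rewrite /discrepancy -(adjointP _ _ Koo) linearD addrAC hilbert_normD.
  by rewrite -(opprB y (K x)) innerNl (innerC (y - K x)); ring.
split=> [[_ xmin]|w0].
  suff : `|adjoint K (y - K x)| ^+ 2 = 0.
    by move/eqP; rewrite sqrf_eq0 normr_eq0 => /eqP.
  apply: (@quad_ge0 _ _ (`|K (adjoint K (y - K x))| ^+ 2)) => [|t].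
    exact: sqr_ge0.
  have := xmin (x + t *: adjoint K (y - K x)) I.
  rewrite DE innerZl inner_norm.
  have -> : K (t *: adjoint K (y - K x)) = t *: K (adjoint K (y - K x)).
    by rewrite linearZ.
  rewrite normrZ exprMn real_normK ?num_real//.
  by lra.
split=> // z _; have := DE (z - x); rewrite w0 addrC subrK innerC inner0l => ->.
by have := sqr_ge0 `|K (z - x)|; lra.
Qed.

(* Main.v *)
Require Import Defs.
From mathcomp Require Import all_boot all_order all_algebra.
From mathcomp Require Import finmap.
From mathcomp Require Import all_classical all_reals all_analysis.
From mathcomp Require Import ring lra.
Import Order.TTheory GRing.Theory Num.Theory.
Import numFieldNormedType.Exports.
Local Open Scope classical_set_scope.
Local Open Scope ring_scope.
Set Implicit Arguments.
Unset Strict Implicit.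
Unset Printing Implicit Defensive.

(** Write D for the discrepancy, B for the l1 ball of radius rad, and
    w = K^*(y - K xt) for a minimizer xt of D on B.

    Descent. Comparing the projection step with any z in B gives
    beta (D x' - D z) <= |x - z|^2 - |x' - z|^2 as soon as
    beta |K (x' - x)|^2 <= |x' - x|^2 ([projected_step_descent]); B2 provides
    this because r <= 1 ([opnorm_gram_le1]).  Taken at a minimizer z, this
    says that the distance to z never increases, and, as beta >= 1, that the
    gap D(x_n) - D(z) is bounded by a telescoping difference and tends to 0
    ([telescope_cvg0]).

    Compactness comes from sparsity instead of the weak topology.  Expanding D
    around xt, D x - D xt = 2 <w, xt - x> + |K (x - xt)|^2, and by optimality
    xt maximizes <w, .> over B.  That maximum is rad times the sup norm of w,
    which is positive because w <> 0.  As w is square summable, only finitely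
    many of its coordinates are comparable to the sup norm, and an x in B with
    <w, x> almost maximal has almost all its mass on that finite set S.  So the
    gap controls the norm of x outside S ([minimizer_gap_controls_tail]), and
    the iterates are asymptotically confined to a finite dimensional box.

    Conclusion. Along an ultrafilter finer than n --> oo the finitely many
    coordinates in S converge and the tails vanish, so the iterates converge in
    norm to some z in B ([ultra_ell2_cvg]).  By continuity D z is minimal.  The
    distance to z is then nonincreasing and arbitrarily small, hence tends to 0
    along the whole sequence ([fejer_cvg]).

    A minimizer exists because the points of least norm in the sublevel sets
    {D <= inf D + 1/(n+1)} of B form a Cauchy sequence
    ([closed_convex_bounded_has_minimizer]). *)

(** * Convex minimization in a Hilbert space *)

Section convex_minimization.
Context {R : realType} {U : hilbertType R}.
Implicit Types (B : set U) (D : U -> R) (p z : U).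

Lemma quad_le0 (a b : R) : 0 <= b ->
  (forall t, 0 <= t <= 1 -> 0 <= t ^+ 2 * b - 2 * t * a) -> a <= 0.
Proof.
move=> b0 h; rewrite leNgt; apply/negP => a0.
have s0 : 0 < a + b + 1 by lra.
pose t := a / (a + b + 1).
have t0 : 0 < t by rewrite divr_gt0.
have tE : t * (a + b + 1) = a by rewrite divfK// gt_eqF.
have t1 : t <= 1 by rewrite ler_pdivrMr// mul1r; lra.
have := h t; rewrite (ltW t0) t1 => /(_ isT).
have -> : t ^+ 2 * b - 2 * t * a = t * (t * b - 2 * a) by ring.
by rewrite pmulr_rge0//; nra.
Qed.

(** First-order optimality on a convex set, for a D that is quadratic along the
    segment from the minimizer p to z: [- 2 * a] is the slope of D there. *)
Lemma minimizer_slope_le0 B D p z (a b : R) : cvx_set B -> is_minimizer D B p ->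
  B z -> 0 <= b ->
  (forall t, D (p + t *: (z - p)) = D p - 2 * t * a + t ^+ 2 * b) -> a <= 0.
Proof.
move=> cB [Bp minp] Bz b0 DE; apply: (quad_le0 b0) => t t01.
have : B (p + t *: (z - p)).
  suff -> : p + t *: (z - p) = t *: z + (1 - t) *: p by exact: cB.
  by rewrite scalerBr scalerBl scale1r addrCA addrA addrAC addrC addrCA addrA.
by move/minp; rewrite DE; lra.
Qed.

Lemma proj_variational B (x p z : U) : cvx_set B ->
  is_minimizer (fun z => `|x - z|) B p -> B z -> inner (x - p) (z - p) <= 0.
Proof.
move=> cB [Bp minp] Bz.
apply: (@minimizer_slope_le0 B (fun z => `|x - z| ^+ 2) p z _ (`|z - p| ^+ 2)) => //.
  split=> // w Bw; rewrite ler_pXn2r ?nnegrE//; exact: minp.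
move=> t; rewrite opprD addrA (hilbert_normB (x - p)) normrZ exprMn.
by rewrite real_normK ?num_real// innerZr; ring.
Qed.

(** The points q_n of least norm in nested convex sets C_n have nondecreasing,
    here bounded, norms.  The midpoint of q_i and q_j lies in the larger of the
    two sets, so the parallelogram law bounds |q_i - q_j| by the variation of
    the squared norms: the q_n are Cauchy. *)
Lemma closed_convex_bounded_has_minimizer B D (c : R) : B !=set0 -> closed B ->
  cvx_set B -> (forall z, B z -> `|z| <= c) -> continuous D ->
  (forall z, 0 <= D z) -> (forall a, cvx_set [set z | D z <= a]) ->
  exists p, is_minimizer D B p.
Proof.
move=> [b Bb] clB cB Bc Dc D0 cD.
have infD : has_inf (D @` B).
  by split; [exists (D b), b|exists 0 => _ [z _ <-]].
pose m := inf (D @` B).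
have mle z : B z -> m <= D z.
  by move=> Bz; apply: ge_inf; [exact: (proj2 infD)|exists z].
pose C (n : nat) := B `&` [set z | D z <= m + n.+1%:R^-1].
have C_proj n : exists p, is_minimizer (fun z => `|0 - z|) (C n) p.
  apply: proj_exists.
  - have n0 : 0 < n.+1%:R^-1 :> R by rewrite invr_gt0.
    have [_ [z Bz <-] zd] := inf_adherent n0 infD.
    by exists z; split=> //; exact: ltW.
  - apply: closedI => //.
    exact: (proj1 (continuous_closedP _) Dc _ (@closed_le _ _)).
  - by move=> u v t t01 [Bu Du] [Bv Dv]; split; [exact: cB|exact: (cD _ u v t)].
have CS i j : (i <= j)%N -> C j `<=` C i.
  move=> ij z [Bz Dz]; split=> //; apply: (le_trans Dz).
  by rewrite lerD2l lef_pV2 ?posrE// ler_nat.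
have [q qP] := choice C_proj.
have qC i j : (i <= j)%N -> C i (q j).
  by move=> ij; apply: (CS _ _ ij); have [] := qP j.
have qmin i z : C i z -> `|q i| ^+ 2 <= `|z| ^+ 2.
  move=> Cz; have [_ /(_ z Cz)] := qP i; rewrite !sub0r !normrN => h.
  by rewrite ler_pXn2r ?nnegrE.
have q_close i j : (i <= j)%N -> `|q i - q j| ^+ 2 <= 2 * (`|q j| ^+ 2 - `|q i| ^+ 2).
  move=> ij; rewrite (mid_norm 0) !sub0r !normrN.
  have : C i (2^-1 *: q i + (1 - 2^-1) *: q j).
    have [Bi Di] := qC _ _ (leqnn i); have [Bj Dj] := qC _ _ ij.
    by split; [apply: cB => //; lra|apply: cD => //; lra].
  by move/qmin; lra.
have /cvg_ex[l ql] : cvgn (fun n => - `|q n| ^+ 2 : R).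
  apply: nonincreasing_is_cvgn.
    by move=> i j ij; rewrite lerN2; apply: qmin; exact: qC.
  exists (- (c ^+ 2)) => _ [n _ <-]; rewrite lerN2.
  have [Bq _] := qC _ _ (leqnn n).
  by rewrite ler_pXn2r ?nnegrE ?Bc// (le_trans _ (Bc _ Bq)).
have cq : cauchy (q @ \oo).
  apply: cauchy_exP => e e0.
  have e20 : 0 < e ^+ 2 / 4 by rewrite divr_gt0// exprn_gt0.
  have /cvgrPdist_lt/(_ _ e20)[N _ Nl] := ql.
  exists (q N), N => // n /= Nn.
  rewrite -ball_normE/= -(@ltr_pXn2r _ 2)// ?nnegrE ?(ltW e0)//.
  apply: (le_lt_trans (q_close _ _ Nn)).
  have := Nl N (leqnn N); have := Nl n Nn => /=; rewrite !ltr_norml.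
  by lra.
have /cvg_ex[p qp] : cvg (q @ \oo) by exact: cauchy_cvg.
have Bp : B p.
  have qB : \forall n \near \oo, B (q n).
    by apply: nearW => n; have [] := qC _ _ (leqnn n).
  exact: (@closed_cvg _ _ _ _ q B clB qB p qp).
exists p; split=> // z /mle; apply: le_trans.
apply/ler_addgt0Pr => e e0.
have Dq : D (q n) @[n --> \oo] --> D p by apply: continuous_cvg => //; exact: Dc.
apply: (cvgr_to_le Dq).
have [N _ Ne] := near_infty_natSinv_lt (PosNum e0).
exists N => // n /= Nn.
have [_ /le_trans] := qC _ _ (leqnn n); apply; rewrite lerD2l ltW//.
exact: Ne.
Qed.

End convex_minimization.

(** * The discrepancy and one projected gradient step *)

Section discrepancy_theory.
Context {R : realType} {U V : hilbertType R}.
Context (K : {linear U -> V}) (y : V) (Koo : (opnorm K < +oo)%E).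
Implicit Types (B : set U) (x p z : U).

Lemma discrepancyD x h : discrepancy K y (x + h) =
  discrepancy K y x - 2 * inner h (adjoint K (y - K x)) + `|K h| ^+ 2.
Proof.
rewrite /discrepancy -(adjointP _ _ Koo) linearD addrAC hilbert_normD.
by rewrite -(opprB y (K x)) innerNl (innerC (y - K x)); ring.
Qed.

Lemma discrepancy_continuous : continuous (discrepancy K y).
Proof.
move=> x.
have cn : `|K z - y| @[z --> x] --> `|K x - y|.
  apply: cvg_norm; apply: cvgB; last exact: cvg_cst.
  exact: (opnorm_continuous Koo).
exact: (cvgM cn cn).
Qed.

Lemma discrepancy_sublevel_cvx (a : R) : cvx_set [set x | discrepancy K y x <= a].
Proof.
move=> u v t /andP[t0 t1] /=; rewrite /discrepancy => ua va.
have -> : K (t *: u + (1 - t) *: v) - y = t *: (K u - y) + (1 - t) *: (K v - y).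
  rewrite linearD !linearZ/= !scalerBr addrACA -opprD -scalerDl.
  by rewrite [t + _]addrC subrK scale1r.
rewrite hilbert_normD !normrZ !exprMn !real_normK ?num_real// innerZl innerZr.
have := sqr_ge0 (`|K u - y| - `|K v - y|); have := inner_le (K u - y) (K v - y).
move: ua va; move: (`|K u - y|) (`|K v - y|) (inner _ _) => p q s pa qa spq pq.
have tt : 0 <= t * (1 - t) by rewrite mulr_ge0// subr_ge0.
have : 2 * s <= p ^+ 2 + q ^+ 2 by lra.
by nra.
Qed.

Lemma discrepancy_minimizer_variational B x z : cvx_set B ->
  is_minimizer (discrepancy K y) B x -> B z ->
  inner (z - x) (adjoint K (y - K x)) <= 0.
Proof.
move=> cB minx Bz.
apply: (minimizer_slope_le0 cB minx Bz (sqr_ge0 `|K (z - x)|)) => t.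
rewrite discrepancyD innerZl.
have -> : K (t *: (z - x)) = t *: K (z - x) by rewrite linearZ.
by rewrite normrZ exprMn real_normK ?num_real//; ring.
Qed.

(** Expanding D p and D z around x, the linear terms combine to
    [<z - p, K^*(y - K x)>]; by the variational inequality of the projection,
    [beta] times this is at most [<p - x, z - p>].  The second-order term at p is
    absorbed by |p - x|^2 because the step is short; the one at z has a
    favourable sign. *)
Lemma projected_step_descent B x p z (beta : R) : cvx_set B -> 0 <= beta ->
  is_minimizer (fun z => `|x + beta *: adjoint K (y - K x) - z|) B p -> B z ->
  beta * `|K (p - x)| ^+ 2 <= `|p - x| ^+ 2 ->
  beta * (discrepancy K y p - discrepancy K y z) <= `|x - z| ^+ 2 - `|p - z| ^+ 2.
Proof.
move=> cB b0 projp Bz short.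
set g := adjoint K (y - K x) in projp *.
have vi := proj_variational cB projp Bz.
have DE w : discrepancy K y w =
    discrepancy K y x - 2 * inner (w - x) g + `|K (w - x)| ^+ 2.
  by rewrite -discrepancyD addrC subrK.
have Kz0 := mulr_ge0 b0 (sqr_ge0 `|K (z - x)|).
rewrite (DE p) (DE z); move: vi short.
rewrite (_ : x - z = (x - p) - (z - p)); last by rewrite opprB addrA subrK.
rewrite (hilbert_normB (x - p)) (distrC p z) (distrC x p).
have -> : x + beta *: g - p = (x - p) + beta *: g by rewrite addrAC.
have -> : inner (z - x) g = inner (z - p) g + inner (p - x) g.
  by rewrite -innerDl addrA subrK.
by rewrite innerDl innerZl (innerC g); lra.
Qed.

End discrepancy_theory.

(** * Coordinates, the l1 ball and finite sections in l2 *)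

Section ell2_coordinates.
Context {R : realType} {L : choiceType}.
Implicit Types (u w x z : ell2 R L) (i j : L) (c M rad : R).

(** Duality between the l1 norm and the sup norm; the negative part of the sum
    defining the inner product is simply dropped. *)
Lemma l1ball_inner_le u x M rad : l1ball rad x -> 0 <= M ->
  (forall i, `|u i| <= M) -> inner u x <= M * rad.
Proof.
rewrite l1ballE /= => xr M0 uM.
have Mx : (\esum_(i in [set: L]) (M * `|x i|)%:E <= (M * rad)%:E)%E.
  rewrite (@nesumZ _ _ M (fun i => `|x i|))// EFinM.
  by apply: lee_pmul => //; apply: nesum_ge0.
set pos := (\esum_(i in [set: L]) (Num.max (u i * x i) 0)%:E)%E.
have pos_le : (pos <= (M * rad)%:E)%E.
  apply: le_trans Mx; apply: le_nesum => i.
  rewrite ge_max mulr_ge0// andbT (le_trans (ler_norm _))// normrM.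
  by rewrite ler_wpM2r.
have pos_fin : pos \is a fin_num.
  apply: nesum_fin (le_lt_trans pos_le (ltry _)) => i.
  by rewrite le_max lexx orbT.
apply: (@le_trans _ _ (fine pos)); last by rewrite -lee_fin fineK.
rewrite -[inner u x]/(rsum _) /rsum lerBlDr lerDl.
by rewrite fine_ge0// nesum_ge0// => i; rewrite le_max lexx orbT.
Qed.

Lemma l1ball_norm_le x rad : 0 <= rad -> l1ball rad x -> `|x| <= rad.
Proof.
move=> rad0 xr.
have [->|x0] := eqVneq x 0; first by rewrite normr0.
have := l1ball_inner_le xr (normr_ge0 x) (ell2_coord_le x).
by rewrite inner_norm expr2 ler_pM2l// normr_gt0.
Qed.

Lemma nesum_single i c : 0 <= c ->
  (\esum_(j in [set: L]) (if j == i then c else 0)%:E = c%:E)%E.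
Proof.
move=> c0; rewrite -[RHS](@esum_set1 R L i (fun=> c%:E)) ?lee_fin//.
rewrite [RHS]esum_mkcond; apply: eq_esum => j _.
by rewrite classical_sets.in_set1; case: ifP.
Qed.

Lemma single_is_ell2 i : (fun j => if j == i then 1 else 0 : R) \in is_ell2.
Proof.
rewrite is_ell2E.
rewrite (_ : (fun j => _) = fun j => (if j == i then 1 else 0 : R)%:E).
  by rewrite nesum_single ?ler01// ltry.
by apply/funext => j; case: ifP; rewrite ?expr1n ?expr0n.
Qed.

Definition ell2_unit i : ell2 R L := Ell2 (single_is_ell2 i).

Lemma inner_unit u i : inner u (ell2_unit i) = u i.
Proof.
rewrite -[LHS]/(rsum _).
rewrite (_ : (fun j => _) = fun j => u i * (if j == i then 1 else 0)); last first.
  by apply/funext => j /=; case: eqVneq => [->//|_]; rewrite !mulr0.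
have sumE : (\esum_(j in [set: L]) (`|if j == i then 1 else 0 : R|%R)%:E = 1%:E)%E.
  rewrite -[RHS](nesum_single i ler01); apply: eq_esum => j _.
  by case: ifP; rewrite ?normr1 ?normr0.
rewrite rsumZ ?sumE ?ltry// rsum_ge0E ?nesum_single ?ler01 ?ltry ?mulr1//.
by move=> j; case: ifP.
Qed.

Lemma l1ball_unit i c rad : `|c| <= rad -> l1ball rad (c *: ell2_unit i).
Proof.
move=> cr; rewrite l1ballE /=.
rewrite (_ : (fun j => _) = fun j => (if j == i then `|c| else 0)%:E).
  by rewrite nesum_single// lee_fin.
apply/funext => j; rewrite -[(c *: _) j]/(c * (if j == i then 1 else 0)).
by case: ifP; rewrite ?mulr1 ?mulr0 ?normr0.
Qed.

Lemma ell2_large_coords_finite w c : 0 < c ->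
  exists S : {fset L}, forall i, i \notin S -> `|w i| <= c.
Proof.
move=> c0; pose A := [set i | c < `|w i|].
have finA : finite_set A.
  apply: contrapT => infA.
  have c20 : 0 < c ^+ 2 by rewrite exprn_gt0.
  have := archi_boundP (divr_ge0 (sqr_ge0 `|w|) (ltW c20)).
  set n := Num.Def.archi_bound _ => wn.
  have [B BA nB] := infinite_set_fset n infA.
  have : n%:R * c ^+ 2 <= `|w| ^+ 2.
    apply: (@le_trans _ _ (\sum_(i <- B) c ^+ 2)).
      by rewrite big_const_seq count_predT iter_addr_0 -[leRHS]mulr_natl
        ler_wpM2r ?ler_nat ?ltW.
    apply: (@le_trans _ _ (\sum_(i <- B) w i ^+ 2)).
      rewrite !big_seq; apply: ler_sum => i /BA /= /ltW ci.
      by rewrite -[w i ^+ 2]real_normK ?num_real// ler_pXn2r ?nnegrE ?(ltW c0).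
    rewrite -inner_norm -[inner w w]/(ell2_inner w w) ell2_inner_sqr -lee_fin.
    rewrite fineK; last by apply: nesum_fin (ell2_fin w) => i; exact: sqr_ge0.
    by apply: (@nesum_ge_fsum _ _ (fun i => w i ^+ 2)) => i; exact: sqr_ge0.
  by rewrite leNgt -ltr_pdivrMr// wn.
exists (fset_set A) => i; rewrite in_fset_set// => /negP iA.
by rewrite leNgt; apply/negP => h; apply: iA; rewrite inE.
Qed.

Lemma ell2_coord_sum (s : seq L) (f : L -> ell2 R L) j :
  (\sum_(i <- s) f i) j = \sum_(i <- s) f i j.
Proof.
elim: s => [|i s ih]; first by rewrite !big_nil.
by rewrite !big_cons ell2_valD ih.
Qed.

(** Written as a sum of unit vectors so that its limits reduce to limits of
    finitely many coordinates. *)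
Definition ell2_proj (S : {fset L}) x : ell2 R L :=
  \sum_(i <- S) x i *: ell2_unit i.

Lemma ell2_projE S x j : ell2_proj S x j = if j \in S then x j else 0.
Proof.
rewrite ell2_coord_sum; under eq_bigr do rewrite ell2_valZ /=.
case: ifPn => jS.
  rewrite (big_fsetD1 j)//= eqxx mulr1 big1_fset ?addr0// => i.
  by rewrite !inE eq_sym => /andP[/negbTE -> _] _; rewrite mulr0.
rewrite big1_fset// => i iS _; case: eqVneq => [ji|_]; last by rewrite mulr0.
by rewrite ji iS in jS.
Qed.

Lemma inner_proj_tail S x : inner (x - ell2_proj S x) x = `|x - ell2_proj S x| ^+ 2.
Proof.
rewrite -inner_norm; congr rsum; apply/funext => j.
by rewrite ell2_valB ell2_projE; case: ifP; rewrite ?subrr ?subr0 ?mul0r.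
Qed.

End ell2_coordinates.

(** * Almost maximal functionals on the l1 ball force sparsity *)

Section sparsity.
Context {R : realType} {L : choiceType}.
Implicit Types (w x z : ell2 R L) (S : {fset L}) (M rad : R).

(** The ball has the vertices [rad] and [- rad] times each unit vector. *)
Lemma l1ball_support_ge w x rad i : 0 <= rad ->
  (forall z, l1ball rad z -> inner z w <= inner x w) ->
  `|w i| * rad <= inner x w.
Proof.
move=> rad0 sup; have := sup ((rad * Num.sg (w i)) *: ell2_unit i).
rewrite innerZl innerC inner_unit -mulrA -normrEsg [rad * `|_|]mulrC; apply.
apply: l1ball_unit; rewrite normrM ger0_norm//.
by rewrite ler_piMr// normr_sg lern1 leq_b1.
Qed.

(** Let T x be the part of x outside S.  The vector w + M / (2 rad) T x still
    has sup norm at most M: on S it is w, and off S each summand is at most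
    M / 2, because |x i| <= rad.  Its inner product with x, which is
    <w, x> + M / (2 rad) |T x|^2, is therefore at most M rad. *)
Lemma l1ball_tail_le w x S M rad : 0 < rad -> l1ball rad x -> 0 <= M ->
  (forall i, `|w i| <= M) -> (forall i, i \notin S -> `|w i| <= M / 2) ->
  M / (2 * rad) * `|x - ell2_proj S x| ^+ 2 <= M * rad - inner w x.
Proof.
move=> rad0 xr M0 wM wS; rewrite lerBrDl -inner_proj_tail -innerZl -innerDl.
have c0 : 0 <= M / (2 * rad) by rewrite divr_ge0// mulr_ge0// ltW.
apply: l1ball_inner_le => // i.
rewrite ell2_valD ell2_valZ ell2_valB ell2_projE.
case: ifPn => [_|iS]; first by rewrite subrr mulr0 addr0.
rewrite subr0; apply: (le_trans (ler_normD _ _)).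
rewrite [leRHS](_ : _ = M / 2 + M / (2 * rad) * rad); last by field; rewrite gt_eqF.
apply: lerD; first exact: wS.
rewrite normrM ger0_norm//; apply: ler_wpM2l => //.
by rewrite (le_trans (ell2_coord_le x i))// l1ball_norm_le// ltW.
Qed.

End sparsity.

(** * Convergence along ultrafilters and Fejer monotonicity *)

Section convergence.
Context {R : realType}.

Lemma ultra_fmap {T T' : Type} (f : T -> T') (F : set_system T) :
  UltraFilter F -> UltraFilter (f @ F).
Proof.
move=> FU; split; first exact: fmap_proper_filter.
move=> G GF FG; apply/seteqP; split=> // A GA.
have [//|FnA] := in_ultra_setVsetC (f @^-1` A) FU.
by have /filter_ex[t []] : G (A `&` ~` A) by apply: filterI => //; exact: FG.
Qed.

Lemma ultra_bounded_cvg {T : Type} (F : set_system T) (f : T -> R) (c : R) :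
  UltraFilter F -> (forall t, `|f t| <= c) -> cvg (f @ F).
Proof.
move=> FU fc; have FfU := ultra_fmap f FU.
have := @segment_compact R (- c) c; rewrite compact_ultra => /(_ _ FfU)[].
  by apply: nearW => t /=; rewrite in_itv /= -ler_norml.
by move=> l [_ fl]; apply/cvg_ex; exists l.
Qed.

Lemma ultra_ell2_cvg {T : Type} {L : choiceType} (F : set_system T)
    (u : T -> ell2 R L) (S : {fset L}) (c : R) :
  UltraFilter F -> (forall t, `|u t| <= c) ->
  u t - ell2_proj S (u t) @[t --> F] --> (0 : ell2 R L) ->
  cvg (u @ F).
Proof.
move=> FU uc tail0.
have coord i : exists l : R, u t i @[t --> F] --> l.
  have /cvg_ex : cvg ((fun t => u t i) @ F).
    by apply: (@ultra_bounded_cvg T F _ c) => t; exact: le_trans (ell2_coord_le _ _) _.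
  by case=> l ul; exists l.
have [l ul] := choice coord.
have head : ell2_proj S (u t) @[t --> F] --> \sum_(i <- S) l i *: ell2_unit i.
  apply: cvg_big => [|i _]; first exact: add_continuous.
  by apply: cvgZ; [exact: ul|exact: cvg_cst].
apply/cvg_ex; exists (\sum_(i <- S) l i *: ell2_unit i).
rewrite -[X in _ --> X]add0r.
rewrite (_ : u = fun t => (u t - ell2_proj S (u t)) + ell2_proj S (u t)).
  exact: cvgD tail0 head.
by apply/funext => t; rewrite subrK.
Qed.

Lemma fejer_cvg {V : normedModType R} (u : nat -> V) (l : V) (F : set_system nat) :
  ProperFilter F -> (forall n, `|u n.+1 - l| <= `|u n - l|) ->
  u @ F --> l -> u @ \oo --> l.
Proof.
move=> FF dec ul; apply/cvgrPdist_lt => e e0.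
have /cvgrPdist_lt/(_ _ e0)/filter_ex[n ne] := ul.
exists n => // m /=; elim: m => [|m ih]; first by rewrite leqn0 => /eqP <-.
rewrite leq_eqVlt => /predU1P[<-//|/ih].
by rewrite !(distrC l); apply: le_lt_trans.
Qed.

Lemma telescope_cvg0 (a d : nat -> R) : (forall n, 0 <= a n) ->
  (forall n, 0 <= d n) -> (forall n, d n.+1 <= a n - a n.+1) ->
  d @ \oo --> (0 : R).
Proof.
move=> a0 d0 da.
have /cvg_ex[l al] : cvgn a.
  apply: nonincreasing_is_cvgn; last by exists 0 => _ [n _ <-].
  apply/nonincreasing_seqP => n.
  by rewrite -subr_ge0 (le_trans _ (da n)).
rewrite -cvg_shiftS /=.
apply: (@squeeze_cvgr _ _ _ _ (fun=> 0) (fun n => a n - a n.+1)).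
- by apply: nearW => n; rewrite d0 da.
- exact: cvg_cst.
- rewrite -(subrr l); apply: cvgB => //.
  by rewrite (cvg_shiftS a).
Qed.

End convergence.
(** * Convergence of the projected gradient iteration *)

Lemma opnorm_gram_le1 {R : realType} {U V : hilbertType R} (K : {linear U -> V}) :
  (opnorm K < 1)%E -> (opnorm (adjoint K \o K) <= 1)%E.
Proof.
move=> K1; have Koo := lt_trans K1 (ltry 1).
have Kle u : `|K u| <= `|u|.
  have K0 : (0 <= opnorm K)%E.
    by apply: ereal_sup_ubound; exists 0; rewrite /= ?normr0// linear0 normr0.
  apply: le_trans (opnorm_bound u Koo) _; rewrite ler_piMl//.
  by rewrite -lee_fin fineK ?ltW// ge0_fin_numE.
have adj_le v : `|adjoint K v| <= `|v|.
  have [->|a0] := eqVneq (adjoint K v) 0; first by rewrite normr0.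
  rewrite -(@ler_pM2r _ `|adjoint K v|) ?normr_gt0// -expr2 -inner_norm.
  rewrite -adjointP// (le_trans (inner_le _ _))// mulrC ler_wpM2l//.
apply: ge_ereal_sup => _ [u /= u1 <-]; rewrite lee_fin.
exact: le_trans (adj_le _) (le_trans (Kle _) u1).
Qed.

(** The maximum M * rad of <w, .> over the ball is attained at x, so M is the sup
    norm of w, and S collects the finitely many coordinates where |w i| exceeds
    M / 2. *)
Lemma minimizer_gap_controls_tail {R : realType} {L : choiceType} {V : hilbertType R}
    (K : {linear ell2 R L -> V}) (y : V) (rad : R) (x : ell2 R L) :
  0 < rad -> (opnorm K < +oo)%E ->
  is_minimizer (discrepancy K y) (l1ball rad) x -> adjoint K (y - K x) <> 0 ->
  exists2 C : R, 0 < C & exists S : {fset L}, forall z, l1ball rad z ->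
    C * `|z - ell2_proj S z| ^+ 2 <= discrepancy K y z - discrepancy K y x.
Proof.
move=> rad_gt0 Koo x_min; set w := adjoint K _ => w_neq0.
have w_sup z : l1ball rad z -> inner z w <= inner x w.
  move=> Bz; have := discrepancy_minimizer_variational Koo (@l1ball_cvx R L rad) x_min Bz.
  by rewrite innerDl innerNl subr_le0.
pose M := inner x w / rad.
have wM i : `|w i| <= M.
  by rewrite ler_pdivlMr//; apply: l1ball_support_ge => //; exact: ltW.
have M_gt0 : 0 < M.
  rewrite ltNge; apply/negP => M0; apply: w_neq0.
  apply: ell2P => i; apply/eqP; rewrite -normr_le0; exact: le_trans (wM i) M0.
have [S wS] := ell2_large_coords_finite w (divr_gt0 M_gt0 (ltr0Sn R 1)).
exists (M / rad); first by rewrite divr_gt0.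
exists S => z Bz.
have := l1ball_tail_le rad_gt0 Bz (ltW M_gt0) wM wS.
have := discrepancyD y Koo x (z - x); rewrite addrC subrK -/w => ->.
have -> : M / (2 * rad) = (M / rad) / 2 by field; rewrite gt_eqF.
rewrite innerDl innerNl (innerC w) [in M * rad]/M divfK ?gt_eqF//.
by have := sqr_ge0 `|K (z - x)|; lra.
Qed.

Theorem theorem5p18 (R : realType) (L : countType)
  (H : hilbertType R) (sepH : is_separable H)
  (rad : R) (rad_gt0 : 0 < rad)
  (y : H)
  (K : {linear ell2 R L -> H}) (K_lt1 : (opnorm K < 1)%E)
  (r : R) (rE : opnorm (adjoint K \o K) = r%:E)
  (not_global : forall xt : ell2 R L,
     is_minimizer (discrepancy K y) (l1ball rad) xt ->
     adjoint K (y - K xt) <> 0)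
  (x : nat -> ell2 R L) (beta : nat -> R)
  (x_rec : forall n : nat,
     x n.+1 = metric_proj (l1ball rad) (x n + beta n *: adjoint K (y - K (x n))))
  (n0 : nat)
  (B1 : (ereal_sup (range (fun n => (beta n)%:E)) < +oo)%E /\
        (1 <= ereal_inf (range (fun n => (beta n)%:E)))%E)
  (B2 : forall n : nat, (n0 <= n)%N ->
     beta n * `|K (x n.+1 - x n)| ^+ 2 <= r * `|x n.+1 - x n| ^+ 2) :
  exists2 xt : ell2 R L,
    is_minimizer (discrepancy K y) (l1ball rad) xt & x @ \oo --> xt.
Proof.
have Koo := lt_trans K_lt1 (ltry 1).
have rad0 := ltW rad_gt0.
have cB := @l1ball_cvx R L rad.
have r1 : r <= 1 by have := opnorm_gram_le1 K_lt1; rewrite rE lee_fin.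
have beta1 n : 1 <= beta n.
  by rewrite -lee_fin (le_trans (proj2 B1))//; apply: ereal_inf_lbound; exists n.
have [xt xt_min] : exists xt, is_minimizer (discrepancy K y) (l1ball rad) xt.
  apply: (closed_convex_bounded_has_minimizer (l1ball_n0 rad0)
    (@l1ball_closed R L rad) cB (fun z => @l1ball_norm_le R L z rad rad0)).
  - exact: discrepancy_continuous.
  - by move=> z; exact: sqr_ge0.
  - by move=> a; exact: discrepancy_sublevel_cvx.
(* Start after [n0] for B2, and one later as [x 0] need not be in the ball. *)
pose u n := x (n + n0.+1)%N.
have uB n : l1ball rad (u n).
  by rewrite /u addnS x_rec; exact: (proj1 (proj_l1ballP _ rad0)).
have descent z n : is_minimizer (discrepancy K y) (l1ball rad) z ->
    discrepancy K y (u n.+1) - discrepancy K y z <= `|u n - z| ^+ 2 - `|u n.+1 - z| ^+ 2.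
  move=> [Bz zmin]; set k := (n + n0.+1)%N.
  have uS : u n.+1 = x k.+1 by rewrite /u addSn.
  have k0 : (n0 <= k)%N by rewrite /k addnS leqW// leq_addl.
  rewrite -[u n]/(x k) uS.
  have projk : is_minimizer (fun z => `|x k + beta k *: adjoint K (y - K (x k)) - z|)
      (l1ball rad) (x k.+1) by rewrite x_rec; exact: proj_l1ballP.
  have b0 : 0 <= beta k by exact: le_trans ler01 _.
  apply: le_trans (projected_step_descent Koo cB b0 projk Bz _); last first.
    by rewrite (le_trans (B2 _ k0))// ler_piMl// sqr_ge0.
  by rewrite ler_peMl// subr_ge0 zmin// -uS.
have Fejer z n : is_minimizer (discrepancy K y) (l1ball rad) z ->
    `|u n.+1 - z| <= `|u n - z|.
  move=> zmin; suff : `|u n.+1 - z| ^+ 2 <= `|u n - z| ^+ 2.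
    by rewrite ler_pXn2r ?nnegrE.
  rewrite -subr_ge0 (le_trans _ (descent z n zmin))// subr_ge0.
  by have [_] := zmin; apply.
have gap0 n : 0 <= discrepancy K y (u n) - discrepancy K y xt.
  by rewrite subr_ge0; have [_] := xt_min; apply.
have gap_cvg : discrepancy K y (u n) - discrepancy K y xt @[n --> \oo] --> (0 : R).
  apply: (@telescope_cvg0 _ (fun n => `|u n - xt| ^+ 2)) => // n.
  exact: (descent xt n xt_min).
have [C C_gt0 [S tail_le]] :=
  minimizer_gap_controls_tail rad_gt0 Koo xt_min (not_global _ xt_min).
have tail0 : u n - ell2_proj S (u n) @[n --> \oo] --> (0 : ell2 R L).
  apply/cvgrPdist_lt => e e0.
  have Ce0 : 0 < C * e ^+ 2 by rewrite mulr_gt0// exprn_gt0.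
  have /cvgrPdist_lt/(_ _ Ce0) := gap_cvg; apply: filterS => n.
  rewrite !sub0r !normrN ger0_norm// => /(le_lt_trans (tail_le _ (uB n))).
  by rewrite ltr_pM2l// ltr_pXn2r ?nnegrE// ltW.
have [F [FU Foo]] := ultraFilterLemma eventually_filter.
have /cvg_ex[z uz] : cvg (u @ F).
  apply: (@ultra_ell2_cvg _ _ _ F u S rad) => //.
    by move=> n; exact: l1ball_norm_le.
  exact: cvg_trans (cvg_app _ Foo) tail0.
have z_min : is_minimizer (discrepancy K y) (l1ball rad) z.
  split.
    have uBF : \forall n \near F, l1ball rad (u n) by exact: nearW.
    exact: (@closed_cvg _ _ _ _ u _ (@l1ball_closed R L rad) uBF z uz).
  suff -> : discrepancy K y z = discrepancy K y xt by have [] := xt_min.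
  have Du : discrepancy K y (u n) @[n --> F] --> discrepancy K y z.
    by apply: continuous_cvg => //; exact: discrepancy_continuous.
  have Du' : discrepancy K y (u n) @[n --> F] --> discrepancy K y xt.
    apply: cvg_trans (cvg_app _ Foo) _.
    by apply/subr_cvg0; exact: gap_cvg.
  by rewrite -(cvg_lim _ Du)// (cvg_lim _ Du').
exists z => //; rewrite -(cvg_shiftn n0.+1).
exact: (fejer_cvg ultra_proper (fun n => Fejer z n z_min) uz).
Qed.
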